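(* For every finite simple graph $G$ with nonempty vertex set and no isolated vertices, $$\tau^2\ \le\ \sqrt{1-(1-\tilde h)^2}.$$ Moreover, the inequality is an equality if and only if $G$ is bipartite or disconnected.
   Context: For a simple graph $G=(V,E)$ on $n$ vertices without isolated vertices, with adjacency matrix $A$ and diagonal degree matrix $D$, the normalized Laplacian is $L:=\mathrm{Id}-D^{-1}A$, with real eigenvalues (counted with multiplicity) $0=\lambda_1\le\lambda_2\le\dots\le\lambda_n\le2$. Set $\tau:=\max_{i\ne1}|1-\lambda_i|$, the maximum being over indices $i\in\{2,\dots,n\}$. For $w\in V$ and $S\subseteq V$, $e(w,S)$ is the number of neighbors of $w$ that lie in $S$, and $\mathrm{vol}\,S:=\sum_{v\in S}\deg v$. For nonempty $S\subseteq V$, $$\tilde h(S):=\frac{1}{\mathrm{vol}\,S}\sum_{w\in V}\frac{e(w,S)^2}{\deg w},\qquad \tilde h:=\max_{\emptyset\ne S\subseteq V,\ \mathrm{vol}\,S\le \mathrm{vol}\,V/2}\tilde h(S).$$ *)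

(* Defs.v *)
From HB Require Import structures.
From mathcomp Require Import all_boot all_order all_algebra.
From mathcomp Require Import polyrcf.

Set Implicit Arguments.
Unset Strict Implicit.
Unset Printing Implicit Defensive.

Import Order.TTheory GRing.Theory Num.Theory.

Local Open Scope ring_scope.

(* A simple graph is a symmetric irreflexive relation e on a finite type T.
   All combinatorial quantities (deg, nbr_in, vol) are natural numbers. *)

Definition nbr_in (T : finType) (e : rel T) (w : T) (S : {set T}) : nat :=
  #|[set v in S | e w v]|.

Definition deg (T : finType) (e : rel T) (v : T) : nat :=
  #|[set w | e v w]|.

Definition vol (T : finType) (e : rel T) (S : {set T}) : nat :=
  (\sum_(v in S) deg e v)%N.

Definition bipartite (T : finType) (e : rel T) : Prop :=
  exists A : {set T}, forall v w, e v w -> (v \in A) != (w \in A).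

Definition connected_graph (T : finType) (e : rel T) : Prop :=
  forall v w, connect e v w.

(* Matrices are indexed by 'I_#|T|; the i-th row is the vertex enum_val i. *)

Definition adjmx (R : rcfType) (T : finType) (e : rel T) : 'M[R]_#|T| :=
  \matrix_(i, j) (e (enum_val i) (enum_val j))%:R.

Definition degmx (R : rcfType) (T : finType) (e : rel T) : 'M[R]_#|T| :=
  diag_mx (\row_i (deg e (enum_val i))%:R).

Definition normalized_laplacian (R : rcfType) (T : finType) (e : rel T) :
    'M[R]_#|T| :=
  1%:M - invmx (degmx R e) *m adjmx R e.

(* The eigenvalues of M lying in R, in nondecreasing order and repeated
   according to algebraic multiplicity. If the characteristic polynomial of M
   splits over R, as it does for the normalized Laplacian (which is similar to
   a symmetric matrix), this is the whole spectrum and has n entries. *)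
Definition eigenvalues (R : rcfType) (n : nat) (M : 'M[R]_n) : seq R :=
  sort <=%R
    (flatten [seq nseq (mup x (char_poly M)) x | x <- rootsR (char_poly M)]).

(* Eigenvalues are numbered from 0, so lambda_1 of the usual numbering is the
   entry 0 and the range below is i = 2, ..., #|T|. The maximum is over
   nonnegative numbers, so that the default value 0 is harmless. *)
Definition tau (R : rcfType) (T : finType) (e : rel T) : R :=
  \big[Num.max/0]_(1 <= i < #|T|)
    `|1 - (eigenvalues (normalized_laplacian R e))`_i|.

Definition htilde_set (R : rcfType) (T : finType) (e : rel T) (S : {set T}) : R :=
  (vol e S)%:R^-1 *
  \sum_(w : T) (nbr_in e w S)%:R ^+ 2 / (deg e w)%:R.

(* Here too the maximum is over nonnegative numbers. *)
Definition htilde (R : rcfType) (T : finType) (e : rel T) : R :=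
  \big[Num.max/0]_(S : {set T} |
      (S != set0) && ((vol e S)%:R <= (vol e [set: T])%:R / 2 :> R))
    htilde_set R e S.

(* Main.v *)
Require Import Defs.
From mathcomp Require Import all_boot all_order all_algebra.
From mathcomp Require Import complex polyrcf ring lra.

(** Let P = D^-1 A be the random walk on G, and let W u v be the sum over w of
    A u w * A w v / deg w, the weighted graph of the two-step walk P^2. It has
    the same degrees as G, and 1 - htilde_set S = W(S, ~S) / vol S. Hence
    h = 1 - htilde is the Cheeger constant of W. Since the eigenvalues of P are
    the 1 - lambda_i, the number tau^2 is the largest eigenvalue of P^2 apart
    from one copy of the trivial eigenvalue 1. The inequality is therefore the
    sharp Cheeger inequality k^2 <= 1 - h^2, for the eigenvalue k = tau^2 of W.

    To prove that inequality (lemma cheeger), take an eigenfunction f that is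
    orthogonal to the constants for the degree measure. Up to sign, its
    positive part g lives on at most half of the volume. Put N = sum deg g^2
    and Q = sum W u v g u g v; the eigenvalue equation gives k N <= Q. Slicing
    g^2 into indicator functions of level sets (lemma coarea) gives
      2 h N <= sum W u v |g u ^2 - g v ^2|,
    and the Cauchy-Schwarz inequality bounds the square of the right-hand side
    by sum W (g u - g v)^2 * sum W (g u + g v)^2 = 4 (N - Q) (N + Q).

    For the equality case, every vertex carries a loop of W, because one can
    step to a neighbour and back. Loops contribute nothing to the sum of the
    |g u ^2 - g v ^2|, but a positive amount to that of the (g u + g v)^2, so
    the Cauchy-Schwarz step has slack unless N = Q, in which case h = 0. Thus
    equality forces h = 0, that is, a set S that two steps of the walk never
    leave; then G is disconnected or bipartite (lemma htilde_set_ge1).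
    Conversely, a bipartition or a disconnection yields an explicit
    eigenfunction of P that is orthogonal to the constants, for the eigenvalue
    -1 or 1. So tau >= 1, while the right-hand side is at most 1.

    What connects this with the sorted list of eigenvalues is that L is similar
    to a symmetric matrix, hence diagonalizable over R. Consequently the
    entries of the list other than the first are exactly those with an
    eigenfunction orthogonal to the constants (lemmas mean_zero_eigenfunction
    and mean_zero_eigenvalue). *)

Set Implicit Arguments.
Unset Strict Implicit.
Unset Printing Implicit Defensive.

Import Order.TTheory GRing.Theory Num.Theory.

Local Open Scope ring_scope.

(** * Finite sums *)

Lemma sum_indicator (R : pzSemiRingType) (T : finType) (S : {set T}) (F : T -> R) :
  \sum_u F u * (u \in S)%:R = \sum_(u in S) F u.
Proof.
rewrite [RHS]big_mkcond; apply: eq_bigr => u _.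
by case: (u \in S); rewrite ?mulr1 ?mulr0.
Qed.

Lemma sum_delta (R : pzSemiRingType) (T : finType) (F : T -> R) j :
  \sum_k (k == j)%:R * F k = F j.
Proof.
rewrite (bigD1 j) //= eqxx mul1r big1 ?addr0 // => k /negbTE ->.
by rewrite mul0r.
Qed.

Lemma count_codom (T : finType) (X : Type) (F : T -> X) (p : pred X) :
  count p [seq F j | j : T] = #|[pred j | p (F j)]|.
Proof. by rewrite count_map cardE -size_filter enumT. Qed.

(** The defect of the inequality is half the sum of the squares
    w i * w j * (a i * b j - a j * b i)^2, by Lagrange's identity. *)
Lemma weighted_cauchy_schwarz (R : realFieldType) (I : finType) (w a b : I -> R) :
  (forall i, 0 <= w i) ->
  (\sum_i w i * (a i * b i)) ^+ 2 <=
  (\sum_i w i * a i ^+ 2) * (\sum_i w i * b i ^+ 2).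
Proof.
move=> w_ge0; rewrite -subr_ge0 -(pmulrn_lge0 _ (ltn0Sn 1)).
suff -> : ((\sum_i w i * a i ^+ 2) * (\sum_i w i * b i ^+ 2)
           - (\sum_i w i * (a i * b i)) ^+ 2) *+ 2 =
          \sum_i \sum_j w i * w j * (a i * b j - a j * b i) ^+ 2.
  apply: sumr_ge0 => i _; apply: sumr_ge0 => j _.
  by rewrite mulr_ge0 ?sqr_ge0 ?mulr_ge0.
have E1 : (\sum_i w i * a i ^+ 2) * (\sum_i w i * b i ^+ 2) =
  \sum_i \sum_j w i * w j * (a i ^+ 2 * b j ^+ 2).
  rewrite big_distrlr; apply: eq_bigr => i _; apply: eq_bigr => j _ /=; ring.
have E2 : (\sum_i w i * a i ^+ 2) * (\sum_i w i * b i ^+ 2) =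
  \sum_i \sum_j w i * w j * (a j ^+ 2 * b i ^+ 2).
  by rewrite E1 exchange_big; apply: eq_bigr => i _; apply: eq_bigr => j _ /=; ring.
have E3 : (\sum_i w i * (a i * b i)) ^+ 2 =
  \sum_i \sum_j w i * w j * (a i * b j * (a j * b i)).
  rewrite expr2 big_distrlr; apply: eq_bigr => i _; apply: eq_bigr => j _ /=; ring.
rewrite mulrnBl mulr2n {1}E1 E2 E3 -big_split -sumrMnl -sumrB.
apply: eq_bigr => i _ /=; rewrite -big_split -sumrMnl -sumrB.
by apply: eq_bigr => j _ /=; ring.
Qed.

(** * The sharp Cheeger inequality for weighted graphs *)

Section WeightedGraph.

Variables (R : realFieldType) (T : finType) (W : T -> T -> R).
Hypothesis W_ge0 : forall u v, 0 <= W u v.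
Hypothesis W_sym : forall u v, W u v = W v u.

Definition wdeg u := \sum_v W u v.
Definition wvol (S : {set T}) := \sum_(u in S) wdeg u.
Definition wcut (S : {set T}) := \sum_(u in S) \sum_(v in ~: S) W u v.

Definition wnorm2 (g : T -> R) := \sum_u wdeg u * g u ^+ 2.
Definition wform (g : T -> R) := \sum_u \sum_v W u v * (g u * g v).

Lemma wdeg_ge0 u : 0 <= wdeg u.
Proof. exact: sumr_ge0. Qed.

Lemma wvol_sub (S S' : {set T}) : S \subset S' -> wvol S <= wvol S'.
Proof.
move=> /subsetP sSS'; rewrite /wvol -!sum_indicator; apply: ler_sum => u _.
by rewrite ler_wpM2l ?wdeg_ge0 // ler_nat; case: (boolP (u \in S)) => // /sSS' ->.
Qed.

Lemma double_wcut (S : {set T}) :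
  \sum_u \sum_v W u v * `|(u \in S)%:R - (v \in S)%:R| = 2 * wcut S.
Proof.
have E u v : W u v * `|(u \in S)%:R - (v \in S)%:R| =
    W u v * (v \in ~: S)%:R * (u \in S)%:R + W v u * (u \in ~: S)%:R * (v \in S)%:R.
  rewrite !inE (W_sym v u); case: (u \in S); case: (v \in S) => /=;
  rewrite ?subrr ?subr0 ?sub0r ?normrN ?normr0 ?normr1; ring.
under eq_bigr do under eq_bigr do rewrite E.
have F : \sum_u \sum_v W u v * (v \in ~: S)%:R * (u \in S)%:R = wcut S.
  rewrite /wcut -sum_indicator; apply: eq_bigr => u _.
  by rewrite -sum_indicator mulr_suml.
under eq_bigr do rewrite big_split /=.
rewrite big_split /= F exchange_big /= F; ring.
Qed.

(** Both sides are additive when phi is decomposed into multiples of nested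
    level-set indicators, and for an indicator the inequality is the hypothesis
    on cuts. Induction on the support removes the bottom layer each time. *)
Lemma coarea (h : R) (phi : T -> R) :
  (forall u, 0 <= phi u) ->
  (forall S : {set T}, S \subset [set u | 0 < phi u] -> h * wvol S <= wcut S) ->
  2 * h * \sum_u wdeg u * phi u <= \sum_u \sum_v W u v * `|phi u - phi v|.
Proof.
have [n] := ubnP #|[set u | 0 < phi u]|; elim: n phi => // n IHn phi card_lt phi_ge0 hS.
have [phi0|[u0]] := set_0Vmem [set u | 0 < phi u].
  rewrite [X in _ * X]big1 ?mulr0 => [|u _].
    by apply: sumr_ge0 => u _; apply: sumr_ge0 => v _; rewrite mulr_ge0.
  have := in_set0 u; rewrite -phi0 inE lt_def phi_ge0 andbT => /negbFE/eqP ->.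
  by rewrite mulr0.
set S := [set u | 0 < phi u] in hS card_lt * => u0S.
have [u1 u1S u1_min] := arg_minP (P := [in S]) phi u0S.
(* The bottom layer has height m, the least positive value of phi. *)
pose m := phi u1; have m_gt0 : 0 < m by move: u1S; rewrite /S inE.
pose psi u := phi u - m * (u \in S)%:R.
have phiE u : phi u = psi u + m * (u \in S)%:R by rewrite subrK.
have psi_out u : u \notin S -> phi u = 0 /\ psi u = 0.
  rewrite /psi => uS; rewrite (negbTE uS) mulr0 subr0.
  by move: uS; rewrite inE lt_def phi_ge0 andbT => /negbNE/eqP.
have psi_ge0 u : 0 <= psi u.
  have [uS|/psi_out[_ ->]//] := boolP (u \in S).
  by rewrite /psi uS mulr1 subr_ge0 u1_min.
have psi_sub : [set u | 0 < psi u] \proper S.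
  apply/properP; split.
    apply/subsetP => u; rewrite !inE; apply: contraTT => uS.
    by have [|_ ->] := psi_out u; rewrite ?inE // ltxx.
  by exists u1; rewrite // inE /psi u1S mulr1 subrr ltxx.
have IH : 2 * h * \sum_u wdeg u * psi u <= \sum_u \sum_v W u v * `|psi u - psi v|.
  apply: IHn => // [|S' S'sub]; first exact: leq_trans (proper_card psi_sub) card_lt.
  by apply/hS/(subset_trans S'sub)/proper_sub.
have -> : \sum_u \sum_v W u v * `|phi u - phi v| =
    \sum_u \sum_v W u v * `|psi u - psi v| + m * (2 * wcut S).
  rewrite -double_wcut mulr_sumr -big_split; apply: eq_bigr => u _ /=.
  rewrite mulr_sumr -big_split; apply: eq_bigr => v _ /=.
  rewrite mulrCA -mulrDr; congr (_ * _); rewrite !phiE.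
  have [uS|uS] := boolP (u \in S); have [vS|vS] := boolP (v \in S).
  - by rewrite subrr normr0 mulr0 addr0; congr `|_|; ring.
  - have [_ ->] := psi_out v vS; have := psi_ge0 u.
    rewrite mulr0 mulr1 !subr0 normr1 addr0 subr0 => p; rewrite !ger0_norm //; last lra.
    by ring.
  - have [_ ->] := psi_out u uS; have := psi_ge0 v.
    rewrite mulr0 mulr1 !sub0r !addr0 !sub0r !normrN normr1 => p.
    by rewrite !ger0_norm //; [ring | lra].
  - by rewrite !mulr0 !addr0 subrr normr0 mulr0 addr0.
have -> : \sum_u wdeg u * phi u = \sum_u wdeg u * psi u + m * wvol S.
  rewrite /wvol -sum_indicator mulr_sumr -big_split; apply: eq_bigr => u _ /=.
  by rewrite {1}phiE; ring.
rewrite mulrDr lerD // -subr_ge0.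
have -> : m * (2 * wcut S) - 2 * h * (m * wvol S) = 2 * m * (wcut S - h * wvol S).
  ring.
by rewrite mulr_ge0 ?subr_ge0 ?hS // mulr_ge0 // ltW.
Qed.

Lemma sum_square_form (s : R) (g : T -> R) :
  \sum_u \sum_v W u v * (g u + s * g v) ^+ 2 =
  (1 + s ^+ 2) * wnorm2 g + 2 * s * wform g.
Proof.
rewrite /wnorm2 /wform.
have E : \sum_u wdeg u * g u ^+ 2 = \sum_u \sum_v W u v * g u ^+ 2.
  by apply: eq_bigr => u _; rewrite mulr_suml.
have E' : \sum_u wdeg u * g u ^+ 2 = \sum_u \sum_v W u v * g v ^+ 2.
  by rewrite E exchange_big; apply: eq_bigr => u _; apply: eq_bigr => v _; rewrite W_sym.
rewrite mulrDl mul1r {1}E E' !mulr_sumr -!big_split; apply: eq_bigr => u _ /=.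
rewrite !mulr_sumr -!big_split; apply: eq_bigr => v _ /=; ring.
Qed.

(** The co-area bound for g^2 combined with Cauchy-Schwarz. The subtracted
    diagonal sum is what the Cauchy-Schwarz step gains by ignoring loops; it
    is the source of strictness. *)
Lemma cheeger_nonneg (h : R) (g : T -> R) :
  0 <= h -> (forall u, 0 <= g u) ->
  (forall S : {set T}, S \subset [set u | 0 < g u] -> h * wvol S <= wcut S) ->
  (h * wnorm2 g) ^+ 2 <=
  (wnorm2 g - wform g) * (wnorm2 g + wform g - 2 * \sum_u W u u * g u ^+ 2).
Proof.
move=> h_ge0 g_ge0 hS; set N := wnorm2 g; set Q := wform g.
set D := \sum_u W u u * g u ^+ 2.
have N_ge0 : 0 <= N by apply: sumr_ge0 => u _; rewrite mulr_ge0 ?wdeg_ge0 ?sqr_ge0.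
have suppE : [set u | 0 < g u ^+ 2] = [set u | 0 < g u].
  by apply/setP => u; rewrite !inE exprn_even_gt0 //= lt_def g_ge0 andbT.
have := @coarea h (fun u => g u ^+ 2) (fun u => sqr_ge0 (g u)).
rewrite suppE => /(_ hS); rewrite -/N => hN.

(* On the diagonal g u ^ 2 - g v ^ 2 vanishes, so the factor b can be
   replaced there by 0 without changing the products. *)
pose b u v := if u == v then 0 else g u + g v.
have CS := weighted_cauchy_schwarz (fun p : T * T => `|g p.1 - g p.2|)
  (fun p => b p.1 p.2) (fun p => W_ge0 p.1 p.2).
rewrite -(pair_bigA _ (fun u v => W u v * (`|g u - g v| * b u v))) in CS.
rewrite -(pair_bigA _ (fun u v => W u v * `|g u - g v| ^+ 2)) in CS.
rewrite -(pair_bigA _ (fun u v => W u v * b u v ^+ 2)) /= in CS.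
have E1 : \sum_u \sum_v W u v * (`|g u - g v| * b u v) =
    \sum_u \sum_v W u v * `|g u ^+ 2 - g v ^+ 2|.
  apply: eq_bigr => u _; apply: eq_bigr => v _; congr (_ * _); rewrite /b.
  have [->|_] := eqVneq u v; first by rewrite !subrr normr0 mulr0.
  by rewrite subr_sqr normrM (ger0_norm (addr_ge0 (g_ge0 u) (g_ge0 v))).
have E2 : \sum_u \sum_v W u v * `|g u - g v| ^+ 2 = 2 * (N - Q).
  transitivity (\sum_u \sum_v W u v * (g u + -1 * g v) ^+ 2).
    apply: eq_bigr => u _; apply: eq_bigr => v _.
    by rewrite real_normK ?num_real // mulN1r.
  by rewrite sum_square_form -/N -/Q; ring.
have E3 : \sum_u \sum_v W u v * b u v ^+ 2 = 2 * (N + Q - 2 * D).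
  have -> : 2 * (N + Q - 2 * D) = 2 * (N + Q) - 4 * D by ring.
  transitivity (\sum_u \sum_v W u v * (g u + 1 * g v) ^+ 2 - 4 * D); last first.
    by rewrite sum_square_form -/N -/Q; ring.
  rewrite /D mulr_sumr -sumrB; apply: eq_bigr => u _.
  rewrite [LHS](bigD1 u) //= [in RHS](bigD1 u) //= /b eqxx.
  rewrite [X in _ + X = _](_ : _ = \sum_(v | v != u) W u v * (g u + 1 * g v) ^+ 2).
    by ring.
  by apply: eq_bigr => v; rewrite eq_sym mul1r => /negbTE ->.
rewrite E1 E2 E3 in CS.
set Y := \sum_u \sum_v _ in CS hN.
have hN0 : 0 <= 2 * h * N by rewrite mulr_ge0 // mulr_ge0.
have : (2 * h * N) ^+ 2 <= Y ^+ 2 by rewrite ler_sqr // nnegrE // (le_trans hN0).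
nra.
Qed.

(** Since f has mean zero, both its positive and its negative part are nonzero
    and one of them is supported on at most half of the volume, so that
    cheeger_nonneg applies to it. *)
Lemma cheeger (h k : R) (f : T -> R) :
  (forall u, 0 < wdeg u) -> (exists u, f u != 0) ->
  \sum_u wdeg u * f u = 0 ->
  (forall u, \sum_v W u v * f v = k * wdeg u * f u) ->
  0 <= k -> 0 <= h ->
  (forall S, 2 * wvol S <= wvol setT -> h * wvol S <= wcut S) ->
  k ^+ 2 <= 1 - h ^+ 2 /\
  (0 < h -> (forall u, 0 < W u u) -> k ^+ 2 < 1 - h ^+ 2).
Proof.
move=> d_gt0 f_neq0 f_orth f_eig k_ge0 h_ge0 hS.
wlog f_half : f f_neq0 f_orth f_eig / 2 * wvol [set u | 0 < f u] <= wvol setT.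
  move=> IH; have [/IH|not_half] := leP (2 * wvol [set u | 0 < f u]) (wvol setT).
    exact.
  apply: (IH (fun u => - f u)).
  - by case: f_neq0 => u fu; exists u; rewrite oppr_eq0.
  - by under eq_bigr do rewrite mulrN; rewrite sumrN f_orth oppr0.
  - by move=> u; under eq_bigr do rewrite mulrN; rewrite sumrN f_eig mulrN.
  have : wvol [set u | 0 < f u] + wvol [set u | 0 < - f u] <= wvol setT.
    rewrite /wvol -!sum_indicator -big_split; apply: ler_sum => u _ /=.
    rewrite !inE mulr1 -mulrDr ger_pMr // oppr_gt0.
    by case: ltgtP; rewrite /= ?addr0 ?add0r.
  lra.
pose g u := Num.max (f u) 0.
have g_ge0 u : 0 <= g u by rewrite le_max lexx orbT.
have g_gt0 u : (0 < g u) = (0 < f u) by rewrite lt_max ltxx orbF.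
have hS' (S : {set T}) : S \subset [set u | 0 < g u] -> h * wvol S <= wcut S.
  move=> Ssub; apply/hS/(le_trans _ f_half); rewrite ler_pM2l // wvol_sub //.
  by apply: subset_trans Ssub _; apply/subsetP => u; rewrite !inE g_gt0.
have := cheeger_nonneg h_ge0 g_ge0 hS'.
set N := wnorm2 g; set Q := wform g; set D := \sum_u W u u * _.
have [u0 fu0] : exists u, 0 < f u.
  have [/existsP//|/existsPn f_le0] := boolP [exists u, 0 < f u].
  case: f_neq0 => u /eqP[]; apply/eqP.
  have term_ge0 v : xpredT v -> 0 <= - (wdeg v * f v).
    by move=> _; rewrite -mulrN mulr_ge0 ?wdeg_ge0 // oppr_ge0 leNgt f_le0.
  have : \sum_v - (wdeg v * f v) == 0 by rewrite sumrN f_orth oppr0.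
  rewrite psumr_eq0 // => /allP/(_ u (mem_index_enum u)).
  by rewrite oppr_eq0 mulf_eq0 (gt_eqF (d_gt0 u)).
have gu0 : 0 < g u0 ^+ 2 by rewrite exprn_gt0 // g_gt0.
have N_gt0 : 0 < N.
  rewrite /N /wnorm2 (bigD1 u0) //=; apply: ltr_pwDl; first by rewrite mulr_gt0.
  by apply: sumr_ge0 => u _; rewrite mulr_ge0 ?wdeg_ge0 ?sqr_ge0.
(* Where f > 0, passing from f to g only enlarges the neighbour sum. *)
have kN_le : k * N <= Q.
  rewrite /N /wnorm2 mulr_sumr; apply: ler_sum => u _.
  have [fu|fu] := ltP 0 (f u); last first.
    rewrite /g (max_r fu) expr0n /= !mulr0 sumr_ge0 // => v _.
    by rewrite mul0r mulr0.
  have gE : g u = f u by rewrite /g max_l // ltW.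
  rewrite mulrA expr2 gE mulrA -f_eig mulr_suml; apply: ler_sum => v _.
  rewrite -!mulrA ler_wpM2l // mulrC ler_wpM2l ?(ltW fu) //.
  by rewrite le_max lexx.
have D_ge0 : 0 <= D by apply: sumr_ge0 => u _; rewrite mulr_ge0 ?sqr_ge0.
have NQ : 0 <= N - Q.
  suff : 0 <= \sum_u \sum_v W u v * (g u + -1 * g v) ^+ 2.
    by rewrite sum_square_form -/N -/Q; lra.
  by apply: sumr_ge0 => u _; apply: sumr_ge0 => v _; rewrite mulr_ge0 ?sqr_ge0.
have kN_sq : (k * N) ^+ 2 <= Q ^+ 2.
  have kN_ge0 : 0 <= k * N by rewrite mulr_ge0 // ltW.
  by rewrite ler_sqr // nnegrE // (le_trans kN_ge0).
have N2_gt0 : 0 < N ^+ 2 by rewrite exprn_gt0.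
move=> main; split=> [|h_gt0 loops].
  have D_term : 0 <= (N - Q) * D by rewrite mulr_ge0.
  rewrite -(ler_pM2l N2_gt0); nra.
have D_gt0 : 0 < D.
  rewrite /D (bigD1 u0) //=; apply: ltr_pwDl; first by rewrite mulr_gt0.
  by apply: sumr_ge0 => u _; rewrite mulr_ge0 ?sqr_ge0.
(* If N = Q, the energy of g vanishes and the main bound gives h * N = 0. *)
have NQ_gt0 : 0 < N - Q.
  rewrite lt_def NQ andbT; apply: contraTN main => /eqP ->.
  by rewrite mul0r -ltNge exprn_gt0 // mulr_gt0.
have D_term : 0 < (N - Q) * D by rewrite mulr_gt0.
rewrite -(ltr_pM2l N2_gt0); nra.
Qed.

End WeightedGraph.

(** * Real diagonalization and the list of eigenvalues *)

(** The complex spectral theorem gives a real diagonal matrix and a complex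
    change of basis; two real matrices similar over R[i] are similar over R. *)
Lemma symmetric_diagonalizable (R : rcfType) n (A : 'M[R]_n) :
  A^T = A ->
  exists P d, P \in unitmx /\ P *m A = diag_mx d *m P.
Proof.
move=> A_sym; pose rc : {rmorphism R -> R[i]} := real_complex R.
have rc_real m p (B : 'M[R]_(m, p)) : map_mx rc B \is a mxOver Num.real.
  by apply/mxOverP => i j; rewrite mxE complex_real.
have rc_Re m p (B : 'M[R[i]]_(m, p)) :
    B \is a mxOver Num.real -> B = map_mx rc (map_mx (@complex.Re R) B).
  by move=> /mxOverP B_real; apply/matrixP => i j; rewrite !mxE; apply/esym/RRe_real.
have AC_real := rc_real _ _ A.
have AC_sym : map_mx rc A \is symmetricmx.
  by apply/is_hermitianmxP; rewrite expr0 scale1r map_mx_id // map_trmx A_sym.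
have /orthomx_spectralP AC_eq := symmetric_normalmx AC_sym AC_real.
have /rc_Re d_real := hermitian_spectral_diag_real (realsym_hermsym AC_sym AC_real).
set P := spectralmx _ in AC_eq; set d := spectral_diag _ in AC_eq d_real.
have P_unit : P \in unitmx := spectral_unit _.
have AC_similar : similar_in unitmx (map_mx rc A) (diag_mx d).
  exists P => //; apply/similarP => //.
  by rewrite [in LHS]AC_eq !mulmxA mulmxV // mul1mx.
have [|Q] := real_similar AC_similar AC_real.
  by rewrite d_real -map_diag_mx rc_real.
rewrite inE => /andP[/rc_Re Q_real Q_unit] /(similarP Q_unit).
rewrite d_real Q_real -map_diag_mx -!map_mxM => /map_mx_inj PA.
exists (map_mx (@complex.Re R) Q), (map_mx (@complex.Re R) d); split=> //.
by rewrite Q_real map_unitmx in Q_unit.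
Qed.

Lemma char_poly_diagonalized (R : fieldType) n (P A : 'M[R]_n) (d : 'rV[R]_n) :
  P \in unitmx -> P *m A = diag_mx d *m P ->
  char_poly A = \prod_j ('X - (d 0 j)%:P).
Proof.
move=> P_unit PA.
have -> : \prod_j ('X - (d 0 j)%:P) = char_poly (diag_mx d).
  rewrite char_poly_trig ?diag_mx_is_trig //.
  by apply: eq_bigr => j _; rewrite mxE eqxx.
have detP_neq0 : \det (map_mx polyC P) != 0.
  by rewrite -/(map_mx _ P) det_map_mx polyC_eq0 -unitfE -unitmxE.
apply: (mulfI detP_neq0); rewrite [RHS]mulrC -!det_mulmx /char_poly_mx.
by rewrite mulmxBl mulmxBr -!map_mxM PA scalar_mxC.
Qed.

(** A diagonalizable matrix has a split characteristic polynomial, so that the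
    roots in R with their multiplicities exhaust the diagonal. *)
Lemma perm_eigenvalues (R : rcfType) n (P A : 'M[R]_n) (d : 'rV[R]_n) :
  P \in unitmx -> P *m A = diag_mx d *m P ->
  perm_eq (eigenvalues A) [seq d 0 j | j : 'I_n].
Proof.
move=> P_unit PA; rewrite perm_sort; apply/allP => x _ /=; apply/eqP.
set s := [seq d 0 j | j : 'I_n].
have -> : char_poly A = \prod_(y <- s) ('X - y%:P).
  by rewrite (char_poly_diagonalized P_unit PA) big_image.
set p := \prod_(y <- s) _.
have p_neq0 : p != 0 by rewrite monic_neq0 // monic_prod_XsubC.
rewrite count_flatten -map_comp sumnE big_map /=.
rewrite (eq_bigr (fun y => if y == x then count_mem x s else 0%N)) => [|y _]; last first.
  rewrite /= count_nseq mu_prod_XsubC /=.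
  by case: eqVneq => [->|_]; [exact: mul1n | exact: mul0n].
rewrite -big_mkcond big_const_seq (count_uniq_mem _ (uniq_roots _ _ _)).
have := roots_on_rootsR p_neq0 x; rewrite in_itv /= => <-.
have [/=|] := boolP (root p x); first by rewrite addn0.
by rewrite /p root_prod_XsubC => /count_memPn ->.
Qed.

(** * The two-step walk and its Cheeger constant *)

Section Graph.

Variables (R : rcfType) (T : finType) (e : rel T).
Hypothesis e_sym : symmetric e.
Hypothesis no_isolated : forall v : T, exists w : T, e v w.

Local Notation adj u v := ((e u v)%:R : R).
Local Notation dg u := ((deg e u)%:R : R).

Lemma deg_gt0 u : 0 < dg u.
Proof.
have [v uv] := no_isolated u; rewrite ltr0n; apply/card_gt0P.
by exists v; rewrite inE.
Qed.

Lemma dg_neq0 u : dg u != 0.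
Proof. by rewrite gt_eqF ?deg_gt0. Qed.

Lemma nbr_inE w S : (nbr_in e w S)%:R = \sum_(v in S) adj w v.
Proof.
rewrite /nbr_in -sum1_card natr_sum [RHS]big_mkcond [LHS]big_mkcond.
by apply: eq_bigr => v _; rewrite inE; case: (v \in S); case: (e w v).
Qed.

Lemma degE u : dg u = \sum_v adj u v.
Proof.
have := nbr_inE u setT; rewrite (eq_bigl xpredT) => [<-|v]; last by rewrite inE.
by rewrite /deg /nbr_in; congr _%:R; apply: eq_card => v; rewrite !inE.
Qed.

(** The entries of A D^-1 A, the conductances of the two-step walk. *)
Definition two_step u v : R := \sum_w adj u w * adj w v / dg w.

Lemma two_step_ge0 u v : 0 <= two_step u v.
Proof. by apply: sumr_ge0 => w _; rewrite !mulr_ge0 ?invr_ge0 ?ler0n. Qed.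

Lemma two_step_sym u v : two_step u v = two_step v u.
Proof.
by apply: eq_bigr => w _; rewrite (e_sym u w) (e_sym w v) [X in X / _]mulrC.
Qed.

Lemma two_step_loop u : 0 < two_step u u.
Proof.
have [v uv] := no_isolated u; rewrite /two_step (bigD1 v) //=.
apply: ltr_pwDl; first by rewrite (e_sym v) uv !mul1r invr_gt0 deg_gt0.
by apply: sumr_ge0 => w _; rewrite !mulr_ge0 ?invr_ge0 ?ler0n.
Qed.

Lemma two_step_apply (f : T -> R) u :
  \sum_v two_step u v * f v =
  \sum_w adj u w / dg w * \sum_v adj w v * f v.
Proof.
under eq_bigr do rewrite mulr_suml.
rewrite exchange_big; apply: eq_bigr => w _ /=; rewrite mulr_sumr.
by apply: eq_bigr => v _; ring.
Qed.

Lemma two_step_wdeg u : wdeg two_step u = dg u.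
Proof.
transitivity (\sum_v two_step u v * 1); first by apply: eq_bigr => v; rewrite mulr1.
rewrite (two_step_apply (fun=> 1)) degE; apply: eq_bigr => w _.
under [X in _ * X]eq_bigr do rewrite mulr1.
by rewrite -degE divfK ?dg_neq0.
Qed.

Lemma two_step_wvol S : wvol two_step S = (vol e S)%:R.
Proof. by rewrite natr_sum; apply: eq_bigr => u _; rewrite two_step_wdeg. Qed.

Lemma two_step_wcut (S : {set T}) :
  wcut two_step S = (vol e S)%:R - \sum_w (nbr_in e w S)%:R ^+ 2 / dg w.
Proof.
have -> : \sum_w (nbr_in e w S)%:R ^+ 2 / dg w = \sum_(u in S) \sum_(v in S) two_step u v.
  under [RHS]eq_bigr do rewrite exchange_big /=.
  rewrite exchange_big; apply: eq_bigr => w _ /=.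
  under eq_bigr do rewrite -!mulr_suml -mulr_sumr.
  rewrite -!mulr_suml -nbr_inE; congr (_ * _).
  by rewrite expr2 [X in X * _]nbr_inE; congr (_ * _); apply: eq_bigr => u _; rewrite e_sym.
rewrite -two_step_wvol /wvol /wcut -sumrB; apply: eq_bigr => u _.
rewrite /wdeg [X in _ = X - _](bigID (mem S)) /= addrAC subrr add0r.
by apply: eq_bigl => v; rewrite inE.
Qed.

Lemma vol_gt0 (S : {set T}) : S != set0 -> 0 < (vol e S)%:R :> R.
Proof.
case/set0Pn => u uS; rewrite -two_step_wvol /wvol (bigD1 u) //= two_step_wdeg.
by apply: ltr_pwDl (deg_gt0 u) _; apply: sumr_ge0 => v _; rewrite two_step_wdeg ler0n.
Qed.

Lemma htilde_setE (S : {set T}) : S != set0 ->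
  1 - htilde_set R e S = wcut two_step S / (vol e S)%:R.
Proof.
move=> /vol_gt0/lt0r_neq0 volS; rewrite two_step_wcut /htilde_set.
by rewrite mulrBl divff // mulrC.
Qed.

Lemma htilde_le1 : htilde R e <= 1.
Proof.
apply: bigmax_le => // S /andP[S_neq0 _]; rewrite -subr_ge0 htilde_setE //.
rewrite divr_ge0 ?ler0n // /wcut; apply: sumr_ge0 => u _.
by apply: sumr_ge0 => v _; rewrite two_step_ge0.
Qed.

(** By htilde_setE, maximizing htilde_set means minimizing the cut ratio, so
    1 - htilde is a Cheeger constant of the two-step walk. *)
Lemma two_step_cheeger (S : {set T}) :
  2 * wvol two_step S <= wvol two_step setT ->
  (1 - htilde R e) * wvol two_step S <= wcut two_step S.
Proof.
have [->|S_neq0] := eqVneq S set0.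
  by move=> _; rewrite /wvol /wcut !big_set0 mulr0.
rewrite !two_step_wvol => S_half; rewrite -ler_pdivlMr ?vol_gt0 // -htilde_setE //.
rewrite lerB // /htilde; apply: le_bigmax_cond; rewrite S_neq0 /=.
by rewrite ler_pdivlMr // mulrC.
Qed.

(** The equation D^-1 A f = mu f, with denominators cleared. *)
Definition walk_eigenfunction (mu : R) (f : T -> R) :=
  forall u, \sum_v adj u v * f v = mu * dg u * f u.

(** The scalar product of f with the constant function 1 for the degree
    measure, which makes the walk self-adjoint. *)
Definition deg_mean (f : T -> R) := \sum_u dg u * f u.

(** An eigenfunction of P for mu is one of P^2 for mu^2, so Cheeger's
    inequality for the two-step walk applies with k = mu^2 >= 0. *)
Lemma walk_cheeger mu f :
  walk_eigenfunction mu f -> (exists u, f u != 0) -> deg_mean f = 0 ->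
  (mu ^+ 2) ^+ 2 <= 1 - (1 - htilde R e) ^+ 2 /\
  (htilde R e < 1 -> (mu ^+ 2) ^+ 2 < 1 - (1 - htilde R e) ^+ 2).
Proof.
move=> f_eig f_neq0 f_mean.
have eig2 u : \sum_v two_step u v * f v = mu ^+ 2 * wdeg two_step u * f u.
  rewrite two_step_apply two_step_wdeg.
  transitivity (mu * \sum_w adj u w * f w); last by rewrite f_eig; ring.
  rewrite mulr_sumr; apply: eq_bigr => w _; rewrite f_eig.
  by field; rewrite dg_neq0.
have [||||main strict] :=
  cheeger two_step_ge0 two_step_sym _ f_neq0 _ eig2 _ _ two_step_cheeger.
- by move=> u; rewrite two_step_wdeg deg_gt0.
- by under eq_bigr do rewrite two_step_wdeg.
- exact: sqr_ge0.
- by rewrite subr_ge0 htilde_le1.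
split=> // ht; apply: strict; first by rewrite subr_gt0.
exact: two_step_loop.
Qed.

(** Eigenfunctions of a self-adjoint operator for different eigenvalues are
    orthogonal; here the other one is the constant function. *)
Lemma deg_mean_eq0 mu f :
  walk_eigenfunction mu f -> mu != 1 -> deg_mean f = 0.
Proof.
move=> f_eig mu_neq1.
suff : (mu - 1) * deg_mean f = 0.
  by move/eqP; rewrite mulf_eq0 subr_eq0 (negbTE mu_neq1) => /eqP.
rewrite mulrBl mul1r /deg_mean mulr_sumr; apply/eqP; rewrite subr_eq0; apply/eqP.
transitivity (\sum_u \sum_v adj u v * f v).
  by apply: eq_bigr => u _; rewrite f_eig mulrA.
rewrite exchange_big; apply: eq_bigr => v _ /=; rewrite -mulr_suml degE.
by under eq_bigr do rewrite e_sym.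
Qed.

Lemma walk_eigenvalue_norm_le1 mu f :
  walk_eigenfunction mu f -> (exists u, f u != 0) -> `|mu| <= 1.
Proof.
move=> f_eig f_neq0; have [->|/(deg_mean_eq0 f_eig) f_mean] := eqVneq mu 1.
  by rewrite normr1.
have [le1 _] := walk_cheeger f_eig f_neq0 f_mean.
rewrite -(expr_le1 (n := 4)) // -normrX ger0_norm ?exprn_even_ge0 //.
rewrite (exprM mu 2 2); apply: le_trans le1 _.
by rewrite gerBl sqr_ge0.
Qed.


(** * The spectrum of the normalized Laplacian *)

Lemma walk_eigenfunction1 : walk_eigenfunction 1 (fun=> 1).
Proof. by move=> u; rewrite mulr1 mul1r degE; apply: eq_bigr => v _; rewrite mulr1. Qed.

Local Notation L := (normalized_laplacian R e).

Lemma degmx_laplacian : degmx R e *m L = degmx R e - adjmx R e.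
Proof.
rewrite /normalized_laplacian mulmxBr mulmx1 mulKVmx // unitmxE det_diag unitfE.
by apply/prodf_neq0 => i _; rewrite mxE dg_neq0.
Qed.

(** With H the square root of D, the matrix N = H L H^-1 equals
    H^-1 (D - A) H^-1, which is symmetric. *)
Lemma laplacian_diagonalizable :
  exists P d, P \in unitmx /\ P *m L = diag_mx d *m P.
Proof.
pose H : 'M[R]_#|T| := diag_mx (\row_i Num.sqrt (dg (enum_val i))).
have HH : H *m H = degmx R e.
  rewrite mulmx_diag; congr diag_mx; apply/rowP => i; rewrite !mxE.
  by rewrite -expr2 sqr_sqrtr ?ler0n.
have H_unit : H \in unitmx.
  rewrite unitmxE det_diag unitfE; apply/prodf_neq0 => i _.
  by rewrite mxE sqrtr_eq0 -ltNge deg_gt0.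
pose N := invmx H *m (degmx R e - adjmx R e) *m invmx H.
have N_sym : N^T = N.
  rewrite /N !trmx_mul trmx_inv tr_diag_mx mulmxA; congr (_ *m _ *m _).
  rewrite linearB /= tr_diag_mx; congr (_ - _).
  by apply/matrixP => i j; rewrite !mxE e_sym.
have HL : H *m L = N *m H.
  by rewrite /N mulmxKV // -degmx_laplacian -HH !mulmxA mulVmx // mul1mx.
have [Q [d [Q_unit QN]]] := symmetric_diagonalizable N_sym.
exists (Q *m H), d; split; first by rewrite unitmx_mul Q_unit.
by rewrite -mulmxA HL (mulmxA Q N) QN -mulmxA.
Qed.

(** The columns of P^-1, where P diagonalizes L, read as functions on the
    vertices. This is all that is used of the matrix L below. *)
Lemma walk_eigenbasis : exists (phi : 'I_#|T| -> T -> R) (d : 'I_#|T| -> R),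
  [/\ perm_eq (eigenvalues L) [seq d j | j : 'I_#|T|],
      forall j, walk_eigenfunction (1 - d j) (phi j),
      forall f : T -> R, exists c : 'I_#|T| -> R, forall u, f u = \sum_j c j * phi j u
    & forall (c : 'I_#|T| -> R) j, c j != 0 -> exists u, \sum_k c k * phi k u != 0].
Proof.
have [P [d [P_unit PL]]] := laplacian_diagonalizable.
pose V := invmx P.
have LV : L *m V = V *m diag_mx d.
  by rewrite /V -[L](mulKmx P_unit) PL !mulmxA mulmxK.
exists (fun j u => V (enum_rank u) j), (fun j => d 0 j); split.
- exact: perm_eigenvalues PL.
- move=> j u.
  have := congr1 (fun M => (degmx R e *m M) (enum_rank u) j) LV.
  rewrite /= mulmxA degmx_laplacian mulmxBl !mul_diag_mx mul_mx_diag !mxE enum_rankK.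
  have -> : \sum_k adjmx R e (enum_rank u) k * V k j = \sum_v adj u v * V (enum_rank v) j.
    rewrite (reindex_onto enum_rank enum_val) /=; last by move=> k _; exact: enum_valK.
    by apply: eq_big => [v|v _]; rewrite ?mxE !enum_rankK ?eqxx.
  move=> eq; rewrite mulrBl mul1r mulrBl -(subKr (dg u * V (enum_rank u) j) (\sum_v _)).
  by rewrite eq; congr (_ - _); ring.
- move=> f; pose x : 'cV[R]_#|T| := \col_i f (enum_val i).
  exists (fun j => (P *m x) j 0) => u.
  transitivity (x (enum_rank u) 0); first by rewrite mxE enum_rankK.
  rewrite -[x in LHS](mulKmx P_unit) mxE.
  by apply: eq_bigr => j _; rewrite mulrC.
- move=> c j cj.
  have [/existsP//|/existsPn c0] :=
    boolP [exists u, \sum_k c k * V (enum_rank u) k != 0].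
  pose x : 'cV[R]_#|T| := \col_i c i.
  have Vx : V *m x = 0.
    apply/colP => i; rewrite [RHS]mxE.
    transitivity (\sum_k c k * V (enum_rank (enum_val i)) k).
      by rewrite mxE; apply: eq_bigr => k _; rewrite enum_valK mxE mulrC.
    exact/eqP/negbNE/c0.
  have : x j 0 != 0 by rewrite mxE.
  by rewrite -[x](mulKVmx P_unit) -/V Vx mulmx0 mxE eqxx.
Qed.

Lemma size_eigenvalues : size (eigenvalues L) = #|T|.
Proof.
have [phi [d [spec _ _ _]]] := walk_eigenbasis.
by rewrite (perm_size spec) size_map -cardE card_ord.
Qed.

(** The eigenvalues mu of the walk satisfy |mu| <= 1. As a consequence, the
    eigenvalue 0 of the constants comes first in the sorted list. *)
Lemma laplacian_eigenvalue_ge0 x : x \in eigenvalues L -> 0 <= x.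
Proof.
have [phi [d [spec eig _ free]]] := walk_eigenbasis.
rewrite (perm_mem spec) => /mapP[j _ ->].
have [u] : exists u, \sum_k (k == j)%:R * phi k u != 0.
  by apply: (free _ j); rewrite eqxx oner_eq0.
rewrite sum_delta => phi_u.
have := walk_eigenvalue_norm_le1 (eig j) (ex_intro _ u phi_u).
by rewrite ler_norml => /andP[_]; lra.
Qed.

Lemma walk_eigenfunctionD mu a b f g :
  walk_eigenfunction mu f -> walk_eigenfunction mu g ->
  walk_eigenfunction mu (fun u => a * f u + b * g u).
Proof.
move=> f_eig g_eig u.
transitivity (a * (\sum_v adj u v * f v) + b * \sum_v adj u v * g v).
  rewrite !mulr_sumr -big_split; apply: eq_bigr => v _ /=; ring.
by rewrite f_eig g_eig; ring.
Qed.

Lemma deg_meanD a b f g :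
  deg_mean (fun u => a * f u + b * g u) = a * deg_mean f + b * deg_mean g.
Proof.
by rewrite /deg_mean !mulr_sumr -big_split; apply: eq_bigr => v _ /=; ring.
Qed.

(** An eigenfunction for a nonzero eigenvalue of L is orthogonal to the
    constants. If the entry of index i is 0, then so is the first one; hence 0
    occurs twice on the diagonal, and a combination of the two corresponding
    basis functions has mean zero. *)
Lemma mean_zero_eigenfunction i : (1 <= i < #|T|)%N ->
  exists f, [/\ walk_eigenfunction (1 - (eigenvalues L)`_i) f,
                exists u, f u != 0 & deg_mean f = 0].
Proof.
move=> /andP[i_gt0 i_lt]; have [phi [d [spec eig _ free]]] := walk_eigenbasis.
have s_ge0 := laplacian_eigenvalue_ge0.
have s_sorted : sorted <=%R (eigenvalues L) by exact/sort_sorted/le_total.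
have := size_eigenvalues; move: s_ge0 s_sorted spec.
case: (eigenvalues L) => [|x s] s_ge0 s_sorted spec s_size; first by rewrite -s_size in i_lt.
case: i i_gt0 i_lt => // i _ i_lt; rewrite /=.
have si_s : s`_i \in s by apply: mem_nth; rewrite -ltnS -[(size s).+1]/(size (x :: s)) s_size.
have /mapP[j _ dj] : s`_i \in [seq d j | j : 'I_#|T|].
  by rewrite -(perm_mem spec) inE si_s orbT.
have [mean_j|mean_j] := eqVneq (deg_mean (phi j)) 0.
  exists (phi j); split=> //; first by rewrite dj; exact: eig.
  have [u] : exists u, \sum_k (k == j)%:R * phi k u != 0.
    by apply: (free _ j); rewrite eqxx oner_eq0.
  by rewrite sum_delta; exists u.
have dj0 : d j = 0.
  apply/eqP; apply: contra_neqT mean_j => dj0; apply: deg_mean_eq0 (eig j) _.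
  by rewrite subr_eq addrC -subr_eq subrr eq_sym.
have x0 : x = 0.
  apply/eqP; rewrite eq_le s_ge0 ?mem_head // andbT -dj0 -dj.
  by move: s_sorted; rewrite /= path_sortedE; [move=> /andP[/allP/(_ _ si_s)]|exact: le_trans].
have [k k_neq dk] : exists2 k, k != j & d k = 0.
  have : (1 < #|[pred j | d j == 0%R]|)%N.
    rewrite -(count_codom d (pred1 0)) -(permP spec) /= x0 eqxx add1n ltnS -has_count; apply/hasP.
    by exists s`_i => //=; rewrite dj dj0.
  rewrite (cardD1 j) inE dj0 eqxx add1n ltnS => /card_gt0P[k].
  by rewrite !inE => /andP[kj /eqP dk]; exists k.
exists (fun u => deg_mean (phi k) * phi j u + - deg_mean (phi j) * phi k u); split.
- by rewrite dj; apply: walk_eigenfunctionD => //; rewrite dj0 -dk.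
- have [|u] := free (fun l => deg_mean (phi k) * (l == j)%:R
                              + - deg_mean (phi j) * (l == k)%:R) k _.
    by rewrite (negbTE k_neq) eqxx mulr0 add0r mulr1 oppr_eq0.
  under eq_bigr do rewrite mulrDl -!mulrA.
  by rewrite big_split /= -!mulr_sumr !sum_delta; exists u.
- by rewrite deg_meanD; ring.
Qed.

(** The value 1 - mu occurs in the list; it has to be found outside of the first
    place. If mu <> 1, the first place is taken by the smaller eigenvalue 0 of
    the constants. If mu = 1, the function f and the constants are linearly
    independent, so 0 occurs twice. *)
Lemma mean_zero_eigenvalue mu f :
  (0 < #|T|)%N ->
  walk_eigenfunction mu f -> (exists u, f u != 0) -> deg_mean f = 0 ->
  exists2 i, (1 <= i < #|T|)%N & (eigenvalues L)`_i = 1 - mu.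
Proof.
move=> /card_gt0P[u0 _] f_eig f_neq0 f_mean.
have [phi [d [spec eig span free]]] := walk_eigenbasis.
(* The coordinates of an eigenfunction vanish outside of its eigenvalue. *)
have coord (nu : R) (g : T -> R) (c : 'I_#|T| -> R) j : walk_eigenfunction nu g ->
    (forall u, g u = \sum_k c k * phi k u) -> c j != 0 -> d j = 1 - nu.
  move=> g_eig gE cj; apply/eqP/negPn/negP => dj.
  have [|u /eqP[]] := free (fun k => c k * (1 - d k - nu)) j.
    by rewrite mulf_neq0 // subr_eq0; apply: contra dj => /eqP <-; rewrite subKr.
  have E : \sum_k c k * ((1 - d k) * dg u * phi k u) = nu * dg u * g u.
    rewrite -g_eig; transitivity (\sum_k \sum_v adj u v * (c k * phi k v)).
      apply: eq_bigr => k _; rewrite -eig mulr_sumr.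
      by apply: eq_bigr => v _; rewrite mulrCA.
    by rewrite exchange_big; apply: eq_bigr => v _; rewrite gE mulr_sumr.
  apply: (mulfI (dg_neq0 u)); rewrite mulr0.
  transitivity (\sum_k c k * ((1 - d k) * dg u * phi k u) - nu * dg u * g u).
    by rewrite gE !mulr_sumr -sumrB; apply: eq_bigr => k _; ring.
  by rewrite E subrr.
have span_neq0 (g : T -> R) (c : 'I_#|T| -> R) : (exists u, g u != 0) ->
    (forall u, g u = \sum_k c k * phi k u) -> exists j, c j != 0.
  move=> [u gu] gE; apply/existsP; apply: contraNT gu => /existsPn c0.
  by rewrite gE big1 // => k _; rewrite (eqP (negbNE (c0 k))) mul0r.
have [cf cfE] := span f; have [c1 c1E] := span (fun=> 1).
have [jf cjf] := span_neq0 f cf f_neq0 cfE.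
have djf := coord mu f cf jf f_eig cfE cjf.
have [|j1 cj1] := span_neq0 (fun=> 1) c1 _ c1E.
  by exists u0; rewrite oner_eq0.
have dj1 : d j1 = 0 by rewrite (coord 1 (fun=> 1) c1) ?subrr //; exact: walk_eigenfunction1.
have in_s j : d j \in eigenvalues L.
  by rewrite (perm_mem spec) map_f // mem_enum.
have s_sorted : sorted <=%R (eigenvalues L) by exact/sort_sorted/le_total.
suff : 1 - mu \in behead (eigenvalues L).
  move: size_eigenvalues; case: (eigenvalues L) => [|x s] //= s_size /(nthP 0)[i i_lt <-].
  by exists i.+1 => //=; rewrite -s_size.
have [mu1|mu_neq1] := eqVneq mu 1.
  rewrite mu1 subrr.
  have : (1 < count_mem 0%R (eigenvalues L))%N.
    rewrite (permP spec) count_codom; apply/card_gt1P.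
    have [/existsP[k /andP[kj1 dk]]|] := boolP [exists k, (k != j1) && (d k == 0)].
      by exists k, j1; split; rewrite ?inE ?dj1.
    move=> /existsPn only; exfalso.
    (* Otherwise f and 1 are both multiples of the same basis function. *)
    have only_j1 (g : T -> R) (c : 'I_#|T| -> R) :
        walk_eigenfunction 1 g -> (forall u, g u = \sum_k c k * phi k u) ->
        forall u, g u = c j1 * phi j1 u.
      move=> g_eig gE u; rewrite gE (bigD1 j1) //= big1 ?addr0 // => k kj1.
      have [->|/(coord 1 g c k g_eig gE) dk] := eqVneq (c k) 0; first by rewrite mul0r.
      by have := only k; rewrite kj1 dk subrr eqxx.
    rewrite mu1 in f_eig.
    have f_j1 := only_j1 f cf f_eig cfE.
    have one_j1 := only_j1 _ c1 walk_eigenfunction1 c1E.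
    have f_const u : f u = cf j1 / c1 j1.
      rewrite f_j1 -[phi j1 u](mulKf cj1) -one_j1; ring.
    have : cf j1 / c1 j1 * \sum_u dg u = 0.
      rewrite -[RHS]f_mean mulr_sumr; apply: eq_bigr => u _.
      by rewrite f_const mulrC.
    have sum_gt0 : 0 < \sum_u dg u.
      rewrite (bigD1 u0) //=; apply: ltr_pwDl (deg_gt0 u0) _.
      by apply: sumr_ge0 => u _; rewrite ler0n.
    move/eqP; rewrite mulf_eq0 (gt_eqF sum_gt0) orbF => /eqP cf0.
    by case: f_neq0 => u; rewrite f_const cf0 eqxx.
  case: (eigenvalues L) => //= x s; rewrite -has_pred1 has_count.
  by case: eqVneq => _; rewrite /= ?add1n ?add0n ?ltnS // => /ltnW.
have := in_s j1; have := in_s jf; rewrite dj1 djf.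
have mu_ge0 : 0 <= 1 - mu by apply: laplacian_eigenvalue_ge0; rewrite -djf.
case: (eigenvalues L) s_sorted => //= x s.
rewrite path_sortedE; last exact: le_trans.
move=> /andP[/allP x_min _]; rewrite !inE => /orP[/eqP xE|//].
rewrite -xE eq_sym subr_eq0 eq_sym (negbTE mu_neq1) /= => /x_min.
rewrite /= -xE => le0; case/eqP: mu_neq1; apply/esym/subr0_eq/le_anti.
by rewrite le0.
Qed.

(** * The equality case *)

Lemma walk_eigenvalue_le_tau mu f :
  walk_eigenfunction mu f -> (exists u, f u != 0) -> deg_mean f = 0 -> `|mu| <= tau R e.
Proof.
move=> f_eig [u fu] f_mean; have T_gt0 : (0 < #|T|)%N by apply/card_gt0P; exists u.
have [i i_bounds lambda_i] := mean_zero_eigenvalue T_gt0 f_eig (ex_intro _ u fu) f_mean.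
apply: (@bigmax_sup_seq _ _ _ _ _ i) => //; first by rewrite mem_index_iota.
by rewrite lambda_i subKr.
Qed.

(** Used with mu = -1 for the two sides of a bipartition, and with mu = 1 for
    functions that are constant on connected components. *)
Lemma edgewise_eigenfunction mu (f : T -> R) :
  (forall u v, e u v -> f v = mu * f u) -> walk_eigenfunction mu f.
Proof.
move=> f_edge u; rewrite mulrAC degE mulr_sumr; apply: eq_bigr => v _.
by case: (boolP (e u v)) => [/f_edge ->|_]; rewrite ?mul0r ?mulr0 // mul1r mulr1.
Qed.

Lemma bipartite_tau : (0 < #|T|)%N -> bipartite e -> 1 <= tau R e.
Proof.
move=> /card_gt0P[u0 _] [A A_bip].
pose f u : R := if u \in A then 1 else -1.
have f_eig : walk_eigenfunction (-1) f.
  apply: edgewise_eigenfunction => u v /A_bip; rewrite /f.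
  by case: (u \in A); case: (v \in A) => //; rewrite mulN1r ?opprK.
have f_mean : deg_mean f = 0.
  by apply: deg_mean_eq0 f_eig _; rewrite -subr_eq0 -opprD oppr_eq0 (pnatr_eq0 _ 2).
rewrite -(normrN1 R); apply: walk_eigenvalue_le_tau f_eig _ f_mean.
by exists u0; rewrite /f; case: ifP; rewrite ?oppr_eq0 oner_eq0.
Qed.

Lemma disconnected_tau : ~ connected_graph e -> 1 <= tau R e.
Proof.
move=> e_disc; have [u0 [v0 uv]] : exists u v, ~~ connect e u v.
  have [/existsP[u /existsP[v uv]]|] := boolP [exists u, exists v, ~~ connect e u v].
    by exists u, v.
  move=> /existsPn conn; case: e_disc => u v.
  by have /existsPn/(_ v)/negbNE := conn u.
pose S := [set w | connect e u0 w].
pose f u : R := if u \in S then (vol e (~: S))%:R else - (vol e S)%:R.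
have f_eig : walk_eigenfunction 1 f.
  apply: edgewise_eigenfunction => u v uv_edge; rewrite mul1r /f !inE.
  by rewrite (same_connect_r (sym_connect_sym e_sym) (connect1 uv_edge)).
have f_mean : deg_mean f = 0.
  rewrite /deg_mean (bigID (mem S)) /=.
  rewrite (eq_bigr (fun u => dg u * (vol e (~: S))%:R)) => [|u uS]; last by rewrite /f uS.
  rewrite [X in _ + X](eq_bigr (fun u => dg u * - (vol e S)%:R)) => [|u uS]; last first.
    by rewrite /f (negbTE uS).
  rewrite -!mulr_suml /vol !natr_sum mulrN mulrC; apply/eqP; rewrite subr_eq0; apply/eqP.
  by congr (_ * _); apply: eq_bigl => u; rewrite inE.
rewrite -[leLHS](normr1 R); apply: walk_eigenvalue_le_tau f_eig _ f_mean.
exists u0; rewrite /f inE connect0 lt0r_neq0 ?vol_gt0 //.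
by apply/set0Pn; exists v0; rewrite !inE.
Qed.

Lemma closed_set_disconnected (S : {set T}) u v :
  (forall x y, e x y -> x \in S -> y \in S) -> u \in S -> v \notin S ->
  ~ connected_graph e.
Proof.
move=> S_closed uS vS e_conn.
have S_cl : fingraph.closed e S.
  by move=> x y xy; apply/idP/idP; [exact: S_closed xy | apply: S_closed; rewrite e_sym].
by rewrite -(closed_connect S_cl (e_conn u v)) uS in vS.
Qed.

(** A cut ratio of 0 means that two steps of the walk never leave S. Let B be
    the set of vertices with a neighbour in S: all the neighbours of a vertex
    of B are in S. Then S :&: B and its mirror image ~: S :&: ~: B are closed
    under adjacency. If one of them is nonempty, it is a proper closed set and
    G is disconnected; if both are empty, B is the complement of S and every
    edge joins S to its complement. *)
Lemma htilde_set_ge1 (S : {set T}) :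
  S != set0 -> (vol e S)%:R <= (vol e setT)%:R / 2 :> R -> 1 <= htilde_set R e S ->
  bipartite e \/ ~ connected_graph e.
Proof.
move=> S_neq0 S_half S_ge1; have volS := vol_gt0 S_neq0.
have two_steps u w v : e u w -> e w v -> u \in S -> v \in S.
  move=> uw wv uS; apply: contraTT S_ge1 => vS; rewrite -ltNge -subr_gt0 htilde_setE //.
  apply: divr_gt0 => //; rewrite /wcut (bigD1 u) //= (bigD1 v) ?inE //=.
  have uv_gt0 : 0 < two_step u v.
    rewrite /two_step (bigD1 w) //= uw wv !mul1r; apply: ltr_pwDl.
      by rewrite invr_gt0 deg_gt0.
    by apply: sumr_ge0 => x _; rewrite !mulr_ge0 ?invr_ge0 ?ler0n.
  apply: ltr_pwDl; first apply: ltr_pwDl => //.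
    by apply: sumr_ge0 => x _; exact: two_step_ge0.
  by apply: sumr_ge0 => x _; apply: sumr_ge0 => y _; exact: two_step_ge0.
pose B := [set w | [exists v in S, e w v]].
have inB w v : e w v -> v \in S -> w \in B.
  by move=> wv vS; rewrite inE; apply/existsP; exists v; rewrite vS.
have /set0Pn[x xS] := S_neq0.
(* S is not everything, since it has at most half of the positive volume. *)
have [y yS] : exists y, y \notin S.
  have [/existsP//|/existsPn allS] := boolP [exists y, y \notin S].
  suff ST : S = setT by move: volS S_half; rewrite ST; lra.
  by apply/setP => y; rewrite inE (negbNE (allS y)).
have [SB0|[u uSB]] := set_0Vmem (S :&: B); last first.
  right; apply: (closed_set_disconnected (S := S :&: B) (v := y) _ uSB); last first.
    by rewrite inE (negbTE yS).
  move=> v w vw; rewrite !in_setI => /andP[vS]; rewrite inE => /existsP[z /andP[zS vz]].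
  by rewrite (two_steps z v w) ?(inB w v) // e_sym.
have [C0|[u uC]] := set_0Vmem (~: S :&: ~: B); last first.
  right; apply: (closed_set_disconnected (S := ~: S :&: ~: B) (v := x) _ uC); last first.
    by rewrite !inE xS.
  move=> v w vw; rewrite !in_setI !in_setC => /andP[vS vB]; apply/andP; split.
    by apply: contra vB; exact: inB.
  apply: contra vS; rewrite inE => /existsP[z /andP[zS wz]].
  by apply: two_steps zS; rewrite e_sym; [exact: wz | exact: vw].
left; exists S => v w vw; have [vS|vS] := boolP (v \in S).
  apply/negP => /eqP/esym wS; have := in_set0 v; rewrite -SB0 inE vS /=.
  by rewrite (inB v w).
have := in_set0 v; rewrite -C0 !in_setI !in_setC vS => /negbFE; rewrite inE.
by move=> /existsP[z /andP[zS vz]]; rewrite (two_steps z v w) // e_sym.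
Qed.

Lemma card_vertices_gt1 : (0 < #|T|)%N -> irreflexive e -> (1 < #|T|)%N.
Proof.
move=> /card_gt0P[u _] e_irr; have [v uv] := no_isolated u.
by apply/card_gt1P; exists u, v; split=> //; apply: contraTneq uv => ->; rewrite e_irr.
Qed.

(** The bound of walk_cheeger on the fourth power of each 1 - lambda_i, after
    two square roots and a maximum. *)
Lemma tau_bound :
  (tau R e ^+ 2 <= Num.sqrt (1 - (1 - htilde R e) ^+ 2)) /\
  ((1 < #|T|)%N -> htilde R e < 1 ->
   tau R e ^+ 2 < Num.sqrt (1 - (1 - htilde R e) ^+ 2)).
Proof.
set b := Num.sqrt _.
have b_ge0 : 0 <= b := sqrtr_ge0 _.
have term i : (1 <= i < #|T|)%N ->
    `|1 - (eigenvalues L)`_i| <= Num.sqrt b /\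
    (htilde R e < 1 -> `|1 - (eigenvalues L)`_i| < Num.sqrt b).
  move=> /mean_zero_eigenfunction[f [f_eig f_neq0 f_mean]].
  have [le_b lt_b] := walk_cheeger f_eig f_neq0 f_mean.
  rewrite -sqrtr_sqr; split=> [|ht].
    by rewrite ler_sqrt // -[leLHS]ger0_norm ?sqr_ge0 // -sqrtr_sqr ler_wsqrtr.
  have b4_gt0 : 0 < 1 - (1 - htilde R e) ^+ 2 by apply: le_lt_trans (lt_b ht); rewrite sqr_ge0.
  rewrite ltr_sqrt ?sqrtr_gt0 // -[ltLHS]ger0_norm ?sqr_ge0 // -sqrtr_sqr ltr_sqrt //.
  exact: lt_b.
have tau_ge0 : 0 <= tau R e by apply: bigmax_ge_id.
split=> [|T_gt1 ht].
  rewrite -(sqr_sqrtr b_ge0) ler_sqr ?nnegrE ?sqrtr_ge0 // /tau big_nat.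
  by apply: bigmax_le => [|i /term[]//]; exact: sqrtr_ge0.
rewrite -(sqr_sqrtr b_ge0) ltr_sqr ?nnegrE ?sqrtr_ge0 // /tau big_nat.
apply: bigmax_lt => [|i /term[_ /(_ ht)]//].
by apply: le_lt_trans (proj2 (term 1%N T_gt1) ht).
Qed.

End Graph.

Theorem theorem6p1 (R : rcfType) (T : finType) (e : rel T)
    (e_sym : symmetric e) (e_irr : irreflexive e)
    (T_nonempty : (0 < #|T|)%N)
    (no_isolated : forall v : T, exists w : T, e v w) :
  tau R e ^+ 2 <= Num.sqrt (1 - (1 - htilde R e) ^+ 2) /\
  (tau R e ^+ 2 = Num.sqrt (1 - (1 - htilde R e) ^+ 2) <->
   bipartite e \/ ~ connected_graph e).
Proof.
have [tau_le tau_lt] := tau_bound R e_sym no_isolated.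
split=> //; split=> [tau_eq|bip_or_disc].
  have ht : ~~ (htilde R e < 1).
    apply/negP => /(tau_lt (card_vertices_gt1 no_isolated T_nonempty e_irr)).
    by rewrite tau_eq ltxx.
  have [/existsP[S /andP[/andP[S_neq0 S_half] S_ge1]]|/existsPn all_lt] :=
    boolP [exists S : {set T}, ((S != set0) &&
      ((vol e S)%:R <= (vol e [set: T])%:R / 2 :> R)) && (1 <= htilde_set R e S)].
    exact: htilde_set_ge1 S_ge1.
  case/negP: ht; apply: bigmax_lt => // S S_ok.
  by have := all_lt S; rewrite S_ok -ltNge.
have tau_ge1 : 1 <= tau R e.
  by case: bip_or_disc; [exact: bipartite_tau | exact: disconnected_tau].
apply: le_anti; rewrite tau_le (le_trans (y := 1)) //; last exact: exprn_ege1.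
by rewrite -[leRHS]sqrtr1 ler_wsqrtr // gerBl sqr_ge0.
Qed.
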